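(* Let $\mathcal{A}$ be a Banach algebra, let $\sigma:\mathcal{A}\to\mathcal{A}$ be a linear mapping, and let $d:\mathcal{A}\to\mathcal{A}$, $d(a)=u\sigma(a)-\sigma(a)u$, be an inner $\sigma$-derivation, where $u\in\mathcal{A}$. If $\sigma^2=\sigma$ and $\sigma(au)=\sigma(a)u$, $\sigma(ua)=u\sigma(a)$ for all $a\in\mathcal{A}$, then there exists a one-parameter group of operators $\{\alpha_t\}_{t\in\mathbb{R}}$ on $\mathcal{A}$ such that $d$ is its $\sigma$-infinitesimal generator and $\alpha_t-\sigma+\iota$ is an inner $\sigma$-endomorphism for all $t\in\mathbb{R}$.
   Context: $\iota$ denotes the identity operator on $\mathcal{A}$. For $u\in\mathcal{A}$, $e^u$ is the usual exponential (computed in the unitization of $\mathcal{A}$ if $\mathcal{A}$ has no unit). That $d(a)=u\sigma(a)-\sigma(a)u$ is an inner $\sigma$-derivation means that $u\in\mathcal{A}$ satisfies $u(\sigma(ab)-\sigma(a)\sigma(b))=(\sigma(ab)-\sigma(a)\sigma(b))u$ for all $a,b\in\mathcal{A}$. A one-parameter group of operators on $\mathcal{A}$ is a family $\{\alpha_t\}_{t\in\mathbb{R}}$ of bounded linear operators on $\mathcal{A}$ with $\alpha_t\alpha_s=\alpha_{t+s}$ for all $t,s\in\mathbb{R}$ and $\alpha_0=\iota$. Its $\sigma$-infinitesimal generator is the mapping $a\mapsto\lim_{t\to0}t^{-1}(\alpha_t(a)-a)$, defined on the set of all $a\in\mathcal{A}$ for which the limit exists. A linear mapping $\alpha:\mathcal{A}\to\mathcal{A}$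 is an inner $\sigma$-endomorphism if there is $v\in\mathcal{A}$ such that $(\alpha+\sigma-\iota)(a)=e^{v}\sigma(a)e^{-v}$ for all $a\in\mathcal{A}$ and $v(\sigma(ab)-\sigma(a)\sigma(b))=(\sigma(ab)-\sigma(a)\sigma(b))v$ for all $a,b\in\mathcal{A}$.
   Formalization: The claim is proved with α_t itself (not α_t − σ + ι) an inner σ-endomorphism, since the printed form fails at t = 0 unless σ = ι; d is also assumed bounded, which is necessary for d to be the generator of a group of bounded operators and is not implied by σ being only linear. *)

(* Defs.v *)
From HB Require Import structures.
From mathcomp Require Export all_boot all_order all_algebra.
From mathcomp Require Export all_classical all_reals all_analysis.
From mathcomp.real_closed Require Export complex.
Export numFieldNormedType.Exports.

Set Implicit Arguments.
Unset Strict Implicit.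
Unset Printing Implicit Defensive.

Import Order.TTheory GRing.Theory Num.Theory.

Local Open Scope classical_set_scope.
Local Open Scope ring_scope.

(* A Banach algebra is real or complex; both cases are covered by letting the
   scalars range over the two values of [scalar_field R]. *)
Variant scalar_kind := RealScalars | ComplexScalars.

Definition scalar_field (R : realType) (k : scalar_kind) : numFieldType :=
  match k with
  | RealScalars => R
  | ComplexScalars => R[i]
  end.

Definition real_scalar (R : realType) (k : scalar_kind) :
    R -> scalar_field R k :=
  match k with
  | RealScalars => fun t => t
  | ComplexScalars => fun t => t%:C%C
  end.

(* The algebra need not be unital (so MathComp's ring structures do not
   apply); the multiplication is carried explicitly. *)
Record banach_algebra (K : numFieldType) (A : completeNormedModType K)
    (mul : A -> A -> A) : Prop := BanachAlgebra {
  ba_mulA : forall a b c, mul a (mul b c) = mul (mul a b) c;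
  ba_mul_linear_l : forall b, linear (fun a => mul a b);
  ba_mul_linear_r : forall a, linear (fun b => mul a b);
  ba_mul_norm_le : forall a b, `|mul a b| <= `|a| * `|b|
}.

Definition algebra_unit (T : Type) (mul : T -> T -> T) (e : T) : Prop :=
  forall a, mul e a = a /\ mul a e = a.

Definition alg_exp (K : numFieldType) (B : normedModType K)
    (mul : B -> B -> B) (one : B) (v : B) : B :=
  limn (series (fun n => (n`!%:R : K)^-1 *: iter n (mul v) one)).

Section Unitization.
Context (K : numFieldType) (A : completeNormedModType K) (mul : A -> A -> A).

(* The library's norm on the product is the max norm. It is equivalent to
   |l| + |a|, the usual norm of the unitization, hence gives the same limits. *)
Definition unitization : normedModType K := (K^o * A)%type.

Definition unitization_mul (x y : unitization) : unitization :=
  (x.1 * y.1, x.1 *: y.2 + y.1 *: x.2 + mul x.2 y.2).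

Definition unitization_one : unitization := (1, 0).

Definition unitization_in (a : A) : unitization := (0, a).

End Unitization.

(* y = e^v x e^(-v), the exponentials being computed in A if A has a unit and
   in the unitization of A otherwise. *)
Definition exp_conjugate (K : numFieldType) (A : completeNormedModType K)
    (mul : A -> A -> A) (v x y : A) : Prop :=
  (forall e, algebra_unit mul e ->
     y = mul (mul (alg_exp mul e v) x) (alg_exp mul e (- v))) /\
  ((forall e, ~ algebra_unit mul e) ->
     let mul1 := unitization_mul mul in
     let exp1 w := alg_exp mul1 (unitization_one A) (unitization_in w) in
     unitization_in y = mul1 (mul1 (exp1 v) (unitization_in x)) (exp1 (- v))).

Section SigmaNotions.
Context (K : numFieldType) (A : completeNormedModType K).
Context (mul : A -> A -> A) (sigma : A -> A).

Definition commutes_with_defect (v : A) : Prop :=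
  forall a b, mul v (sigma (mul a b) - mul (sigma a) (sigma b)) =
              mul (sigma (mul a b) - mul (sigma a) (sigma b)) v.

Definition inner_sigma_derivation (u : A) (d : A -> A) : Prop :=
  (forall a, d a = mul u (sigma a) - mul (sigma a) u) /\
  commutes_with_defect u.

(* (alpha + sigma - id)(a) = e^v sigma(a) e^(-v). With v = 0, the identity is an
   inner sigma-endomorphism, whatever sigma is. *)
Definition inner_sigma_endomorphism (alpha : A -> A) : Prop :=
  linear alpha /\
  exists v, (forall a, exp_conjugate mul v (sigma a) (alpha a + sigma a - a)) /\
            commutes_with_defect v.

End SigmaNotions.

Definition bounded_operator (K : numFieldType) (A : normedModType K)
    (f : A -> A) : Prop :=
  linear f /\ exists M : K, forall x, `|f x| <= M * `|x|.

Definition one_parameter_group (R : realType) (K : numFieldType)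
    (A : normedModType K) (alpha : R -> A -> A) : Prop :=
  [/\ forall t, bounded_operator (alpha t),
      forall t s a, alpha (t + s) a = alpha t (alpha s a) &
      forall a, alpha 0 a = a].

Section Generator.
Context (R : realType) (k : scalar_kind) (A : normedModType (scalar_field R k)).
Variable alpha : R -> A -> A.

Definition difference_quotient (a : A) (t : R) : A :=
  (real_scalar k t)^-1 *: (alpha t a - a).

Definition generator_domain : set A :=
  [set a | cvg (difference_quotient a t @[t --> 0^'])].

Definition generator (a : A) : A := lim (difference_quotient a t @[t --> 0^']).

(* d being defined on all of A, the domain of the generator is required to be
   everything. By Banach-Steinhaus, such a generator of a group of bounded
   operators is itself bounded. *)
Definition is_generator (d : A -> A) : Prop :=
  generator_domain = setT /\ generator = d.

End Generator.

(* Main.v *)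
From HB Require Import structures.
Require Import Defs.
From mathcomp Require Import ring.

(* On the range of sigma the map d acts as the commutator ad_u = L_u - R_u with
   u, and sigma d = d, so d^n = ad_u^n sigma for n > 0.  Hence the group
   alpha_t = e^(t d) satisfies alpha_t + sigma - id = e^(t ad_u) sigma.  Since
   L_u and R_u commute, e^(t ad_u) = e^(-t R_u) e^(t L_u), which is conjugation
   by e^(t u).  That exponentials of commuting bounded operators multiply is
   obtained by comparing the square and triangular partial sums of the double
   series with those of the scalar series of e^p e^q = e^(p + q). *)

Set Implicit Arguments.
Unset Strict Implicit.
Unset Printing Implicit Defensive.

Import Order.TTheory GRing.Theory Num.Theory.

Local Open Scope classical_set_scope.
Local Open Scope ring_scope.

(** * Real scalars inside the real or complex scalar field *)

Definition scalar_re (R : realType) (k : scalar_kind) : scalar_field R k -> R :=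
  match k with
  | RealScalars => fun x => x
  | ComplexScalars => fun x => complex.Re x
  end.

Section RealScalar.
Context (R : realType) (k : scalar_kind).
Local Notation rs := (@real_scalar R k).

Lemma real_scalarK : cancel rs (@scalar_re R k).
Proof. by case: k. Qed.

(** The order of [R[i]] relates only numbers with equal imaginary parts, so a nonnegative scalar is
    real. *)
Lemma scalar_reK (x : scalar_field R k) : 0 <= x -> rs (scalar_re x) = x.
Proof.
case: k x => // -[a b]; rewrite lecE /= => /andP[/eqP b0 _].
by rewrite b0.
Qed.

Lemma real_scalar_is_zmod_morphism : zmod_morphism rs.
Proof. by case: k => // x y; rewrite /= rmorphB. Qed.

Lemma real_scalar_is_monoid_morphism : monoid_morphism rs.
Proof. by case: k; split=> // x y; rewrite /= rmorphM. Qed.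

HB.instance Definition _ := GRing.isZmodMorphism.Build R (scalar_field R k) rs
  real_scalar_is_zmod_morphism.
HB.instance Definition _ := GRing.isMonoidMorphism.Build R (scalar_field R k) rs
  real_scalar_is_monoid_morphism.

Lemma ler_real_scalar : {mono rs : x y / x <= y}.
Proof. by case: k => // x y; rewrite /= lecR. Qed.

Lemma ltr_real_scalar : {mono rs : x y / x < y}.
Proof. by case: k => // x y; rewrite /= ltcR. Qed.

(** Lets every epsilon in the scalar field be replaced by a real one. *)
Lemma real_scalar_gt0 (x : scalar_field R k) :
  0 < x -> exists2 e : R, 0 < e & x = rs e.
Proof.
move=> x0; exists (scalar_re x); last by rewrite scalar_reK// ltW.
by rewrite -ltr_real_scalar rmorph0 scalar_reK// ltW.
Qed.

Lemma normr_real_scalar x : `|rs x| = rs `|x|.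
Proof. by case: k x => //= x; rewrite normc_def /= expr0n addr0 sqrtr_sqr. Qed.

End RealScalar.

(** * Real-valued norms and convergence *)

Section RealNorm.
Context (R : realType) (k : scalar_kind).
Local Notation K := (scalar_field R k).
Local Notation rs := (@real_scalar R k).

(* The norm of V takes its values in K, hence possibly in R[i]; all estimates are
   made with this real-valued copy of it. *)
Definition real_norm (V : normedZmodType K) (x : V) : R := scalar_re `|x|.

Lemma real_normE (V : normedZmodType K) (x : V) : rs (real_norm x) = `|x|.
Proof. exact: scalar_reK. Qed.

Lemma real_norm_ge0 (V : normedZmodType K) (x : V) : 0 <= real_norm x.
Proof. by rewrite -(ler_real_scalar k) real_normE rmorph0. Qed.

Lemma real_norm0 (V : normedZmodType K) : real_norm (0 : V) = 0.
Proof. by rewrite /real_norm normr0 -(rmorph0 rs) real_scalarK. Qed.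

Lemma real_normN (V : normedZmodType K) (x : V) : real_norm (- x) = real_norm x.
Proof. by rewrite /real_norm normrN. Qed.

Lemma ler_real_normD (V : normedZmodType K) (x y : V) :
  real_norm (x + y) <= real_norm x + real_norm y.
Proof. by rewrite -(ler_real_scalar k) rmorphD /= !real_normE ler_normD. Qed.

Lemma ler_real_norm_sum (V : normedZmodType K) I (r : seq I) (P : pred I)
    (F : I -> V) :
  real_norm (\sum_(i <- r | P i) F i) <= \sum_(i <- r | P i) real_norm (F i).
Proof.
rewrite -(ler_real_scalar k) rmorph_sum /= real_normE.
rewrite (le_trans (ler_norm_sum _ _ _))// le_eqVlt; apply/orP; left.
by apply/eqP/eq_bigr => i _; rewrite real_normE.
Qed.

Lemma real_normZ (V : normedModType K) (c : K) (x : V) :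
  real_norm (c *: x) = real_norm c * real_norm x.
Proof. by apply: (can_inj (@real_scalarK R k)); rewrite rmorphM /= !real_normE normrZ. Qed.

Lemma real_norm_real_scalar (t : R) : real_norm (rs t) = `|t|.
Proof. by rewrite /real_norm normr_real_scalar real_scalarK. Qed.

Lemma real_scalar_natV n : (n%:R : K)^-1 = rs n%:R^-1.
Proof. by rewrite fmorphV rmorph_nat. Qed.

Lemma real_norm_natV n : real_norm (n%:R^-1 : K) = n%:R^-1.
Proof. by rewrite real_scalar_natV real_norm_real_scalar ger0_norm ?invr_ge0. Qed.

Lemma cvgr_real_norm (V : normedModType K) T (F : set_system T) {FF : Filter F}
    (f : T -> V) (l : V) :
  real_norm (f t - l) @[t --> F] --> (0 : R) -> f t @[t --> F] --> l.
Proof.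
move=> /cvgr0Pnorm_le fl; apply/subr_cvg0/cvgr0Pnorm_le => _ /real_scalar_gt0[e /fl + ->].
by apply: filterS => t; rewrite ger0_norm ?real_norm_ge0// -real_normE ler_real_scalar.
Qed.

Lemma real_norm_cvg0 (V : normedModType K) T (F : set_system T) {FF : Filter F}
    (f : T -> V) (l : V) :
  f t @[t --> F] --> l -> real_norm (f t - l) @[t --> F] --> (0 : R).
Proof.
move=> /subr_cvg0/cvgr0Pnorm_le fl; apply/cvgr0Pnorm_le => e e0.
have /fl : 0 < rs e by rewrite -(rmorph0 rs) ltr_real_scalar.
by apply: filterS => t; rewrite ger0_norm ?real_norm_ge0// -real_normE ler_real_scalar.
Qed.

Lemma cvgr_real_norm_le (V : normedModType K) T (F : set_system T)
    {FF : Filter F} (f : T -> V) (l : V) (g : T -> R) :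
  (\forall t \near F, real_norm (f t - l) <= g t) ->
  g t @[t --> F] --> (0 : R) -> f t @[t --> F] --> l.
Proof.
move=> fg g0; apply: cvgr_real_norm.
apply: (@squeeze_cvgr _ _ _ _ (fun=> 0) g) => //; last exact: cvg_cst.
by apply: filterS fg => t ->; rewrite real_norm_ge0.
Qed.

Lemma real_norm_cvg_le (V : normedModType K) T (F : set_system T)
    {FF : ProperFilter F} (f : T -> V) (l : V) (M : R) :
  (forall t, real_norm (f t) <= M) -> f t @[t --> F] --> l -> real_norm l <= M.
Proof.
move=> fM fl.
(* By the triangle inequality the norm of [l] is at most M + |f t - l| for every t, and this bound
   tends to M. *)
have {}fl : M + real_norm (f t - l) @[t --> F] --> M.
  by rewrite -[X in _ --> X]addr0; apply: cvgD; [exact: cvg_cst|exact: real_norm_cvg0].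
rewrite -(cvg_lim (@Rhausdorff R) fl); apply: limr_ge; first by apply: cvgP fl.
apply: nearW => t; rewrite -{1}(subKr (f t) l) (le_trans (ler_real_normD _ _))//.
by rewrite real_normN lerD2r.
Qed.

(** Comparison test: blocks of the series of [f] are dominated by those of [g], so the Cauchy
    criterion carries over, and [V] is complete. *)
Lemma is_cvg_series_real_norm_le (V : completeNormedModType K) (f : V ^nat)
    (g : R ^nat) :
  (forall n, real_norm (f n) <= g n) -> cvgn (series g) -> cvgn (series f).
Proof.
move=> fg /cauchy_cvgP/cauchy_seriesP cg; apply/cauchy_cvgP/cauchy_seriesP => _ /real_scalar_gt0[e /cg + ->].
apply: filterS => n gn; rewrite -real_normE ltr_real_scalar.
apply: le_lt_trans gn; rewrite (le_trans (ler_real_norm_sum _ _ _))//.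
by rewrite (le_trans _ (ler_norm _))// ler_sum.
Qed.

End RealNorm.

(** * Triangular double sums and the binomial formula for operators *)

(** Both sides run over the pairs with i + j < N, first by diagonals and then by rows. *)
Lemma sum_diagonals (V : nmodType) (f : nat -> nat -> V) N :
  \sum_(n < N) \sum_(i < n.+1) f i (n - i)%N =
  \sum_(i < N) \sum_(j < N - i) f i j.
Proof.
elim: N => [|N IH]; first by rewrite !big_ord0.
rewrite big_ord_recr/= IH [RHS]big_ord_recr/= subSnn big_ord_recr/= big_ord1.
rewrite subnn addrA; congr (_ + _); rewrite -big_split/=; apply: eq_bigr => i _.
by rewrite subSn 1?ltnW// big_ord_recr.
Qed.

Lemma iter_linear (K : nzRingType) (V : lmodType K) (D : {linear V -> V}) n :
  linear (iter n D).
Proof. by elim: n => // n IH a x y; rewrite !iterS IH linearP. Qed.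

HB.instance Definition _ (K : nzRingType) (V : lmodType K)
    (D : {linear V -> V}) n :=
  GRing.isLinear.Build K V V *:%R (iter n D) (iter_linear D n).

Lemma iter_comm (T : Type) (f g : T -> T) : (forall x, f (g x) = g (f x)) ->
  forall n x, iter n f (g x) = g (iter n f x).
Proof. by move=> fg; elim=> // n IH x; rewrite !iterS IH fg. Qed.

Lemma iterDn_comm (K : nzRingType) (V : lmodType K) (D E : {linear V -> V}) :
  (forall x, D (E x) = E (D x)) -> forall n x,
  iter n (D \+ E) x = \sum_(i < n.+1) iter i D (iter (n - i) E x) *+ 'C(n, i).
Proof.
move=> DE n x; pose f i j := iter i D (iter j E x).
rewrite -[RHS]/(\sum_(i < n.+1) f i (n - i)%N *+ 'C(n, i)).
have DEf i j : (D \+ E) (f i j) = f i.+1 j + f i j.+1.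
  by rewrite /f/= (iter_comm DE).
elim: n => [|n IH]; first by rewrite big_ord1 bin0.
rewrite iterS IH linear_sum/=.
rewrite (eq_bigr (fun i : 'I_n.+1 => f i.+1 (n - i)%N *+ 'C(n, i) +
    f i (n - i).+1 *+ 'C(n, i))); last first.
  by move=> i _; rewrite -mulrnDl -DEf/= !raddfMn mulrnDl.
(* Pascal's rule: the terms with i = 0 are matched first; the remaining coefficients split by
   [binS], where the extra last term has 'C(n, n + 1) = 0. *)
rewrite big_split/= [in RHS]big_ord_recl/= [X in _ + X]big_ord_recl/= !bin0 subn0.
rewrite addrCA; congr (_ + _).
under [RHS]eq_bigr => i _ do rewrite /bump/= add1n binS mulrnDr subSS.
rewrite big_split/= addrC; congr (_ + _).
rewrite [RHS]big_ord_recr/= bin_small// mulr0n addr0.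
by apply: eq_bigr => i _; rewrite /bump/= add1n subnSK.
Qed.

(** Dividing the binomial formula by n! gives the n-th diagonal of the product of the two
    exponential series. *)
Lemma iterDn_comm_fact (K : numFieldType) (V : lmodType K)
    (D E : {linear V -> V}) :
  (forall x, D (E x) = E (D x)) -> forall n x,
  (n`!%:R : K)^-1 *: iter n (D \+ E) x =
  \sum_(i < n.+1) (i`!%:R^-1 * (n - i)`!%:R^-1) *: iter i D (iter (n - i) E x).
Proof.
move=> DE n x; rewrite iterDn_comm// scaler_sumr; apply: eq_bigr => i _.
rewrite -[_ *+ 'C(_, _)]scaler_nat scalerA; congr (_ *: _).
have fact0 m : (m`!%:R : K) != 0 by rewrite pnatr_eq0 -lt0n fact_gt0.
rewrite -(bin_fact (ltn_ord i : (i <= n)%N)) !natrM.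
have C0 : ('C(n, i)%:R : K) != 0 by rewrite pnatr_eq0 -lt0n bin_gt0 -ltnS.
by field; rewrite C0 !fact0.
Qed.

(** * The scalar exponential series as a majorant *)

Section RealExp.
Context (R : realType).
Implicit Types p q : R.

Lemma cvg_exp_coeff_sum p : (\sum_(n < N) exp_coeff p n) @[N --> \oo] --> expR p.
Proof.
under eq_fun do rewrite -(big_mkord xpredT (exp_coeff p)).
exact: is_cvg_series_exp_coeff.
Qed.

Lemma exp_coeff_sum_le p N : 0 <= p -> \sum_(n < N) exp_coeff p n <= expR p.
Proof.
move=> p0; rewrite -(big_mkord xpredT (exp_coeff p)).
apply: (@nondecreasing_cvgn_le _ (series (exp_coeff p))) => //.
  by apply: nondecreasing_series => n _ _; exact: exp_coeff_ge0.
exact: is_cvg_series_exp_coeff.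
Qed.

Lemma exp_coeffD p q n :
  exp_coeff (p + q) n = \sum_(i < n.+1) exp_coeff p i * exp_coeff q (n - i)%N.
Proof.
rewrite /exp_coeff/= addrC exprDn mulr_suml; apply: eq_bigr => i _.
have fact0 m : (m`!%:R : R) != 0 by rewrite pnatr_eq0 -lt0n fact_gt0.
have C0 : ('C(n, i)%:R : R) != 0 by rewrite pnatr_eq0 -lt0n bin_gt0 -ltnS.
rewrite -(bin_fact (ltn_ord i : (i <= n)%N)) !natrM -[_ *+ _]mulr_natr.
move: (q ^+ _) (p ^+ _) => y x.
by field; rewrite C0 !fact0.
Qed.

(** The corner i + j >= N of the N by N square is the square partial sum minus the triangular one,
    so it tends to e^p e^q - e^(p + q) = 0. *)
Lemma cvg_exp_coeff_corner p q :
  \sum_(i < N) \sum_((N - i)%N <= j < N) exp_coeff p i * exp_coeff q j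
    @[N --> \oo] --> (0 : R).
Proof.
have -> : (fun N => \sum_(i < N) \sum_((N - i)%N <= j < N) exp_coeff p i * exp_coeff q j)
  = (fun N => (\sum_(i < N) exp_coeff p i) * (\sum_(j < N) exp_coeff q j)
      - \sum_(n < N) exp_coeff (p + q) n).
  apply/funext => N; under [X in _ - X]eq_bigr do rewrite exp_coeffD.
  rewrite (sum_diagonals (fun i j => exp_coeff p i * exp_coeff q j)).
  rewrite mulr_suml -sumrB; apply: eq_bigr => i _.
  rewrite mulr_sumr -!(big_mkord xpredT (fun j => exp_coeff p i * exp_coeff q j)).
  by rewrite [in RHS](big_cat_nat (n := (N - i)%N))//= ?leq_subr// addrC addrK.
have c r := @cvg_exp_coeff_sum r.
by have := cvgB (cvgM (c p) (c q)) (c (p + q)); rewrite -expRD subrr; apply.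
Qed.

End RealExp.

(** * Exponentials of bounded operators *)

Section ExpOp.
Context (R : realType) (k : scalar_kind).
Local Notation K := (scalar_field R k).
Local Notation rs := (@real_scalar R k).
Context (V : completeNormedModType K).
Implicit Types (D E : {linear V -> V}) (m p q : R).

(** The constant is kept explicit because it becomes the argument of the majorising scalar
    exponential. *)
Definition op_bound (D : V -> V) m :=
  0 <= m /\ forall x, real_norm (D x) <= m * real_norm x.

Definition exp_sum (D : V -> V) N (a : V) : V :=
  \sum_(n < N) (n`!%:R : K)^-1 *: iter n D a.

(** e^D as a pointwise limit, so that all estimates take place in [V]. A bare function is accepted,
    which allows commutators written as plain lambdas. *)
Definition exp_op (D : V -> V) (a : V) : V := limn (exp_sum D ^~ a).

Lemma op_boundZ D p (c : K) : op_bound D p -> op_bound (c \*: D) (real_norm c * p).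
Proof.
move=> [p0 Dp]; split=> [|x]; first by rewrite mulr_ge0 ?real_norm_ge0.
by rewrite /= real_normZ -mulrA ler_wpM2l ?real_norm_ge0.
Qed.

Lemma real_norm_iter D m : op_bound D m ->
  forall n x, real_norm (iter n D x) <= m ^+ n * real_norm x.
Proof.
move=> [m0 Dm]; elim=> [|n IH] x; first by rewrite expr0 mul1r.
by rewrite iterS (le_trans (Dm _))// exprS -mulrA ler_wpM2l.
Qed.

Lemma real_norm_exp_term D m : op_bound D m -> forall n x,
  real_norm ((n`!%:R : K)^-1 *: iter n D x) <= exp_coeff m n * real_norm x.
Proof.
move=> Dm n x; rewrite real_normZ real_norm_natV /exp_coeff/= mulrAC [leRHS]mulrC.
by rewrite ler_wpM2l ?invr_ge0// real_norm_iter.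
Qed.

Lemma cvg_exp_op D m : op_bound D m ->
  forall a, exp_sum D N a @[N --> \oo] --> exp_op D a.
Proof.
move=> Dm a; rewrite /exp_op /exp_sum.
have -> : (fun N => \sum_(n < N) (n`!%:R : K)^-1 *: iter n D a) =
    series (fun n => (n`!%:R : K)^-1 *: iter n D a).
  by apply/funext => N; rewrite seriesEord.
apply: is_cvg_series_real_norm_le (real_norm_exp_term Dm ^~ a) _.
apply: (cvgP (expR m * real_norm a)).
rewrite seriesEord; under eq_fun do rewrite -mulr_suml.
by apply: cvgM; [exact: cvg_exp_coeff_sum|exact: cvg_cst].
Qed.

Arguments cvg_exp_op {D m} Dm a.

Lemma exp_op_unique D a l : exp_sum D N a @[N --> \oo] --> l -> exp_op D a = l.
Proof. exact: cvg_lim. Qed.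

Lemma exp_sum_linear D N : linear (exp_sum D N).
Proof.
move=> c x y; rewrite /exp_sum scaler_sumr -big_split; apply: eq_bigr => i _.
by rewrite linearP scalerDr !scalerA mulrC.
Qed.

HB.instance Definition _ D N :=
  GRing.isLinear.Build K V V *:%R (exp_sum D N) (exp_sum_linear D N).

Lemma real_norm_exp_sum D m N a : op_bound D m ->
  real_norm (exp_sum D N a) <= expR m * real_norm a.
Proof.
move=> Dm; rewrite (le_trans (ler_real_norm_sum _ _ _))//.
rewrite (@le_trans _ _ (\sum_(n < N) exp_coeff m n * real_norm a))//.
  by apply: ler_sum => n _; exact: real_norm_exp_term.
by rewrite -mulr_suml ler_wpM2r ?real_norm_ge0// exp_coeff_sum_le//; case: Dm.
Qed.

Lemma exp_op_linear D m : op_bound D m -> linear (exp_op D).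
Proof.
move=> Dm c x y; apply: exp_op_unique.
under eq_fun do rewrite linearP.
by apply: cvgD; [apply: cvgZr|]; exact: cvg_exp_op Dm _.
Qed.

Lemma exp_op_bound D m : op_bound D m -> op_bound (exp_op D) (expR m).
Proof.
move=> Dm; split=> [|a]; first exact: expR_ge0.
by apply: (real_norm_cvg_le _ (cvg_exp_op Dm a)) => N; exact: real_norm_exp_sum.
Qed.

(** Without its first two terms the series is bounded through (n + 2)! >= n!. This second-order
    remainder yields both e^0 = id and the derivative of e^(tD) at t = 0. *)
Lemma exp_op_sub_le D m a : op_bound D m ->
  real_norm (exp_op D a - a - D a) <= m ^+ 2 * expR m * real_norm a.
Proof.
move=> Dm; have m0 := Dm.1.
have : exp_sum D (N + 2) a - a - D a @[N --> \oo] --> exp_op D a - a - D a.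
  apply: cvgB; last exact: cvg_cst.
  apply: cvgB; last exact: cvg_cst.
  by move/cvg_exp_op: Dm => /(_ a); rewrite -(cvg_shiftn 2).
move=> cvgD; apply: (real_norm_cvg_le _ cvgD) => N.
have -> : exp_sum D (N + 2) a - a - D a =
    \sum_(n < N) (n.+2`!%:R : K)^-1 *: iter n.+2 D a.
  rewrite addn2 /exp_sum 2!big_ord_recl/= !fact0 invr1 !scale1r.
  by rewrite [a + _]addrC addrK [D a + _]addrC addrK.
rewrite (le_trans (ler_real_norm_sum _ _ _))//.
apply: (@le_trans _ _ (\sum_(n < N) m ^+ 2 * exp_coeff m n * real_norm a)).
  apply: ler_sum => n _; rewrite (le_trans (real_norm_exp_term Dm _ _))//.
  rewrite ler_wpM2r ?real_norm_ge0// /exp_coeff/= mulrA -exprD.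
  rewrite ler_wpM2l ?exprn_ge0// lef_pV2 ?posrE ?ltr0n ?fact_gt0//.
  by rewrite ler_nat; apply: leq_fact; rewrite -addn2 leq_addr.
rewrite -mulr_suml -mulr_sumr ler_wpM2r ?real_norm_ge0//.
by rewrite ler_wpM2l ?exprn_ge0// exp_coeff_sum_le.
Qed.

(** The inner argument varies with N; the bound e^p on the outer partial sums, uniform in N, absorbs
    this. *)
Lemma cvg_exp_sum_exp_sum D E p q a : op_bound D p -> op_bound E q ->
  exp_sum D N (exp_sum E N a) @[N --> \oo] --> exp_op D (exp_op E a).
Proof.
move=> Dp Eq; set b := exp_op E a.
apply: (@cvgr_real_norm_le _ _ _ _ _ _ _ _ (fun N =>
  expR p * real_norm (exp_sum E N a - b) + real_norm (exp_sum D N b - exp_op D b))).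
  apply: nearW => N; rewrite -[exp_sum E N a in leLHS](subrK b) linearD -addrA.
  by rewrite (le_trans (ler_real_normD _ _))// lerD2r real_norm_exp_sum.
rewrite -[X in _ --> X]addr0 -[X in _ --> X + _](mulr0 (expR p)).
apply: cvgD; last exact: real_norm_cvg0 (cvg_exp_op Dp _).
by apply: cvgM; [exact: cvg_cst|exact: real_norm_cvg0 (cvg_exp_op Eq _)].
Qed.

(** The square partial sums tend to e^D (e^E a). The triangular ones, which belong to D + E, differ
    by a corner whose norm is at most the scalar corner times the norm of [a]. *)
Lemma exp_opD D E p q a : (forall x, D (E x) = E (D x)) ->
  op_bound D p -> op_bound E q -> exp_op (D \+ E) a = exp_op D (exp_op E a).
Proof.
move=> DE Dp Eq; apply: exp_op_unique.
pose f i j : V := ((i`!%:R : K)^-1 * j`!%:R^-1) *: iter i D (iter j E a).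
have sumD N : exp_sum (D \+ E) N a = \sum_(i < N) \sum_(j < N - i) f i j.
  rewrite -(sum_diagonals f); apply: eq_bigr => n _.
  exact: iterDn_comm_fact.
have mulD N : exp_sum D N (exp_sum E N a) = \sum_(i < N) \sum_(j < N) f i j.
  apply: eq_bigr => i _; rewrite linear_sum scaler_sumr; apply: eq_bigr => j _.
  by rewrite linearZ scalerA.
have corner N : exp_sum D N (exp_sum E N a) - exp_sum (D \+ E) N a =
    \sum_(i < N) \sum_((N - i)%N <= j < N) f i j.
  rewrite sumD mulD -sumrB; apply: eq_bigr => i _.
  rewrite -!(big_mkord xpredT (f i)).
  by rewrite (big_cat_nat (n := (N - i)%N))//= ?leq_subr// addrC addrK.
have -> : exp_sum (D \+ E) ^~ a = fun N => exp_sum D N (exp_sum E N a) -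
    (exp_sum D N (exp_sum E N a) - exp_sum (D \+ E) N a).
  by apply/funext => N; rewrite subKr.
rewrite -[X in _ --> X]subr0.
apply: cvgB; first exact: cvg_exp_sum_exp_sum Dp Eq.
apply: (@cvgr_real_norm_le _ _ _ _ _ _ _ _ (fun N =>
  (\sum_(i < N) \sum_((N - i)%N <= j < N) exp_coeff p i * exp_coeff q j)
    * real_norm a)).
  apply: nearW => N; rewrite subr0 corner (le_trans (ler_real_norm_sum _ _ _))//.
  rewrite mulr_suml ler_sum// => i _; rewrite (le_trans (ler_real_norm_sum _ _ _))//.
  rewrite mulr_suml ler_sum// => j _.
  have -> : f i j = i`!%:R^-1 *: iter i D (j`!%:R^-1 *: iter j E a).
    by rewrite linearZ scalerA.
  rewrite (le_trans (real_norm_exp_term Dp _ _))// -mulrA ler_wpM2l//.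
    by rewrite exp_coeff_ge0//; case: Dp.
  exact: real_norm_exp_term.
rewrite -[X in _ --> X](mul0r (real_norm a)).
by apply: cvgM; [exact: cvg_exp_coeff_corner|exact: cvg_cst].
Qed.

End ExpOp.

(** * The group e^(tD) and its generator *)

Section ExpGroup.
Context (R : realType) (k : scalar_kind).
Local Notation K := (scalar_field R k).
Local Notation rs := (@real_scalar R k).
Context (V : completeNormedModType K).
Implicit Types (D : {linear V -> V}) (m : R).

Lemma op_bound_cvg (T : V -> V) m I (F : set_system I) {FF : Filter F}
    (f : I -> V) l : linear T -> op_bound T m ->
  f t @[t --> F] --> l -> T (f t) @[t --> F] --> T l.
Proof.
move=> Tlin [m0 Tm] fl.
pose TL : {linear V -> V} := HB.pack T (GRing.isLinear.Build K V V *:%R T Tlin).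
apply: (@cvgr_real_norm_le _ _ _ _ _ _ _ _ (fun t => m * real_norm (f t - l))).
  by apply: nearW => t; rewrite -[T]/(TL : V -> V) -linearB.
rewrite -[X in _ --> X](mulr0 m).
by apply: cvgM; [exact: cvg_cst|exact: real_norm_cvg0].
Qed.

Lemma bounded_operator_op_bound (D : V -> V) :
  bounded_operator D <-> linear D /\ exists m, op_bound D m.
Proof.
split=> [[Dlin [M DM]]|[Dlin [m [m0 Dm]]]]; split=> //.
  (* [M] is an arbitrary scalar, possibly not real, but M |x| dominates a norm and hence equals its
     own absolute value |M| |x|. *)
  exists (real_norm M); split=> [|x]; first exact: real_norm_ge0.
  rewrite -(ler_real_scalar k) rmorphM /= !real_normE (le_trans (DM x))//.
  have : 0 <= M * `|x| by apply: le_trans (DM x).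
  by move=> /ger0_norm <-; rewrite normrM normr_id.
by exists (rs m) => x; rewrite -!real_normE -rmorphM ler_real_scalar.
Qed.

Lemma exp_op_one_parameter_group D m : op_bound D m ->
  one_parameter_group (fun t => exp_op (rs t \*: D)).
Proof.
move=> Dm; have Dt t := op_boundZ (rs t) Dm; split=> [t|t s a|a].
- apply/bounded_operator_op_bound; split; first exact: exp_op_linear (Dt t).
  by exists (expR (real_norm (rs t) * m)); exact: exp_op_bound (Dt t).
- rewrite -(exp_opD _ _ (Dt t) (Dt s)).
    congr (exp_op _ a); apply/funext => x /=.
    by rewrite rmorphD scalerDl.
  by move=> x; rewrite /= !linearZ/= !scalerA mulrC.
(* For t = 0 the operator bound is 0, so the remainder estimate forces e^0 a = a. *)
- have := exp_op_sub_le a (Dt 0).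
  rewrite rmorph0 real_norm0 mul0r expr0n !mul0r => le0.
  have /eqP : real_norm (exp_op (rs 0 \*: D) a - a - (rs 0 \*: D) a) = 0.
    by apply/eqP; rewrite eq_le real_norm_ge0 rmorph0 le0.
  rewrite -(inj_eq (can_inj (@real_scalarK R k))) real_normE rmorph0 normr_eq0.
  by rewrite /= scale0r subr0 subr_eq0 => /eqP.
Qed.

Lemma exp_op_generator D m : op_bound D m ->
  is_generator (fun t => exp_op (rs t \*: D)) D.
Proof.
move=> Dm; pose alpha t := exp_op (rs t \*: D).
suff lim a : difference_quotient alpha a t @[t --> 0^'] --> D a.
  split; last by apply/funext => a; exact: cvg_lim (lim a).
  by rewrite -subTset => a _; exact: cvgP (lim a).
(* For |t| <= 1 the remainder estimate for tD is at most |t|^2 C, since e^(|t| m) <= e^m; dividing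
   by t leaves |t| C. *)
pose C := m ^+ 2 * expR m * real_norm a.
apply: (@cvgr_real_norm_le _ _ _ _ _ _ _ _ (fun t => `|t| * C)); last first.
  rewrite -[X in _ --> X](mul0r C) -[X in X * C](normr0 R).
  apply: cvgM; last exact: cvg_cst.
  by apply: cvg_norm; exact: nbhs_dnbhs.
near=> t.
have t0 : t != 0 by near: t; exact: nbhs_dnbhs_neq.
have t1 : `|t| <= 1.
  by near: t; exact: dnbhs0_le.
have [m0 _] := Dm.
have -> : difference_quotient alpha a t - D a =
    (rs t)^-1 *: (alpha t a - a - (rs t \*: D) a).
  rewrite [RHS]scalerBr /= scalerA mulVf ?scale1r//.
  by rewrite fmorph_eq0.
rewrite real_normZ -fmorphV real_norm_real_scalar normfV.
rewrite ler_pdivrMl ?normr_gt0//.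
rewrite (le_trans (exp_op_sub_le _ (op_boundZ (rs t) Dm)))//.
rewrite real_norm_real_scalar /C exprMn !mulrA -expr2 -[_ * m * m]mulrA -expr2.
rewrite ler_wpM2r ?real_norm_ge0// ler_wpM2l ?mulr_ge0 ?exprn_ge0//.
by rewrite ler_expR ler_piMl.
Unshelve. all: by end_near. Qed.

End ExpGroup.

(** * Multiplication operators and conjugation by exponentials *)

Section Conjugation.
Context (R : realType) (k : scalar_kind).
Local Notation K := (scalar_field R k).
Context (A : completeNormedModType K) (mul : A -> A -> A).
Hypothesis A_banach : banach_algebra mul.

Definition lmul (w : A) : {linear A -> A} := HB.pack (mul w)
  (GRing.isLinear.Build K A A *:%R (mul w) (ba_mul_linear_r A_banach w)).

Definition rmul (w : A) : {linear A -> A} := HB.pack (mul ^~ w)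
  (GRing.isLinear.Build K A A *:%R (mul ^~ w) (ba_mul_linear_l A_banach w)).

Lemma ler_real_normM (x y : A) : real_norm (mul x y) <= real_norm x * real_norm y.
Proof.
by rewrite -(ler_real_scalar k) rmorphM /= !real_normE ba_mul_norm_le.
Qed.

Lemma op_bound_lmul w : op_bound (lmul w) (real_norm w).
Proof. by split=> [|x]; [exact: real_norm_ge0|exact: ler_real_normM]. Qed.

Lemma op_bound_rmul w : op_bound (rmul w) (real_norm w).
Proof.
by split=> [|x]; [exact: real_norm_ge0|rewrite mulrC; exact: ler_real_normM].
Qed.

(** [iter n (mul w) w] is the power w^(n + 1), written so as to make sense without a unit. *)
Lemma iter_lmulM w x n : mul (iter n (mul w) w) x = iter n.+1 (lmul w) x.
Proof.
elim: n => [//|n IH]; rewrite [RHS]iterS -IH iterS.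
by rewrite -(ba_mulA A_banach).
Qed.

Lemma iter_rmulM w x n : mul x (iter n (mul w) w) = iter n.+1 (rmul w) x.
Proof.
elim: n x => [//|n IH] x; rewrite [RHS]iterSr -IH iterS.
by rewrite (ba_mulA A_banach).
Qed.

(* e^w - 1, which makes sense in A even when A has no unit *)
Definition alg_expm1 (w : A) : A :=
  limn (series (fun n => (n.+1`!%:R : K)^-1 *: iter n (mul w) w)).

Lemma cvg_alg_expm1 w :
  \sum_(n < N) (n.+1`!%:R : K)^-1 *: iter n (mul w) w @[N --> \oo] --> alg_expm1 w.
Proof.
have : cvgn (series (fun n => (n.+1`!%:R : K)^-1 *: iter n (mul w) w)).
  apply: (is_cvg_series_real_norm_le
    (g := fun n => exp_coeff (real_norm w) n * real_norm w)); last first.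
    apply: (cvgP (expR (real_norm w) * real_norm w)).
    rewrite seriesEord; under eq_fun do rewrite -mulr_suml.
    by apply: cvgM; [exact: cvg_exp_coeff_sum|exact: cvg_cst].
  (* Since (n + 1)! >= n!, the term is dominated by the n-th term of the exponential of [lmul w] at
     [w]. *)
  move=> n; apply: le_trans (real_norm_exp_term (op_bound_lmul w) _ _).
  rewrite !real_normZ !real_norm_natV ler_wpM2r ?real_norm_ge0//.
  by rewrite lef_pV2 ?posrE ?ltr0n ?fact_gt0// ler_nat; exact: leq_fact.
by rewrite /alg_expm1 seriesEord.
Qed.

Arguments cvg_alg_expm1 : clear implicits.

(** Left multiplication by e^w, stated without a unit: after the term n = 0, continuity of right
    multiplication by [x] carries the series of e^w - 1 to the rest. *)
Lemma exp_op_lmul w x : exp_op (lmul w) x = x + mul (alg_expm1 w) x.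
Proof.
apply: exp_op_unique; rewrite -cvg_shiftS /=.
under eq_fun => N do rewrite /exp_sum big_ord_recl/= invr1 scale1r.
apply: cvgD; first exact: cvg_cst.
have := op_bound_cvg (ba_mul_linear_l A_banach x) (op_bound_rmul x) (cvg_alg_expm1 w).
under eq_fun => N.
  rewrite -[mul _ x]/(rmul x _) linear_sum.
  under eq_bigr => n _ do rewrite linearZ/= iter_lmulM.
  over.
exact.
Qed.

Lemma exp_op_rmul w x : exp_op (rmul w) x = x + mul x (alg_expm1 w).
Proof.
apply: exp_op_unique; rewrite -cvg_shiftS /=.
under eq_fun => N do rewrite /exp_sum big_ord_recl/= invr1 scale1r.
apply: cvgD; first exact: cvg_cst.
have := op_bound_cvg (ba_mul_linear_r A_banach x) (op_bound_lmul x) (cvg_alg_expm1 w).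
under eq_fun => N.
  rewrite -[mul x _]/(lmul x _) linear_sum.
  under eq_bigr => n _ do rewrite linearZ/= iter_rmulM.
  over.
exact.
Qed.

Lemma alg_exp_unital e w : algebra_unit mul e -> alg_exp mul e w = e + alg_expm1 w.
Proof.
move=> eP; apply: cvg_lim => //; rewrite seriesEord -cvg_shiftS /=.
under eq_fun => N do rewrite big_ord_recl/= invr1 scale1r.
apply: cvgD; first exact: cvg_cst.
have := cvg_alg_expm1 w; under eq_fun => N.
  under eq_bigr => n _ do rewrite -{2}(eP w).2 -iterSr.
  over.
exact.
Qed.

(** The positive powers of (0, w) stay in the copy of [A], so only the term n = 0 contributes to the
    scalar component. *)
Lemma alg_exp_unitization w :
  alg_exp (unitization_mul mul) (unitization_one A) (unitization_in w) =
  (1, alg_expm1 w) :> unitization A.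
Proof.
have iterE n : iter n.+1 (unitization_mul mul (unitization_in w)) (unitization_one A)
    = unitization_in (iter n (mul w) w).
  elim: n => [|n IH]; last rewrite iterS IH.
    rewrite /= /unitization_mul/= mul0r scale0r add0r scale1r.
    by rewrite -[mul w 0]/(lmul w 0) linear0 addr0.
  by rewrite /unitization_mul/= mul0r !scale0r !add0r.
apply: cvg_lim => //; rewrite seriesEord -cvg_shiftS /=.
have -> : (fun N => \sum_(n < N.+1) (n`!%:R : K)^-1 *:
      iter n (unitization_mul mul (unitization_in w)) (unitization_one A)) =
    (fun N => (1, \sum_(n < N) (n.+1`!%:R : K)^-1 *: iter n (mul w) w) : unitization A).
  apply/funext => N; rewrite big_ord_recl/= invr1 scale1r.
  rewrite (eq_bigr (fun n : 'I_N => unitization_in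
    ((n.+1`!%:R : K)^-1 *: iter n (mul w) w))); last first.
    by move=> n _; rewrite -iterS iterE /unitization_in; congr (_, _); rewrite scaler0.
  have -> : \sum_(n < N) unitization_in ((n.+1`!%:R : K)^-1 *: iter n (mul w) w) =
      unitization_in (\sum_(n < N) (n.+1`!%:R : K)^-1 *: iter n (mul w) w).
    symmetry; apply: big_morph => // x y.
    by rewrite /unitization_in; congr (_, _); rewrite addr0.
  by congr (_, _); rewrite /= (addr0, add0r).
exact: (@cvg_pair _ K^o A \oo (nbhs (1 : K^o)) _ _ _ _ (fun=> 1) _
  (cvg_cst (1 : K^o)) (cvg_alg_expm1 w)).
Qed.

(** By associativity left and right multiplications commute, so the exponential of the commutator
    factors. With or without a unit, the conjugate expands to the same expression in e^v - 1 and
    e^(-v) - 1. *)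
Lemma exp_conjugate_exp_op v x :
  exp_conjugate mul v x (exp_op (fun y => mul v y - mul y v) x).
Proof.
have -> : (fun y => mul v y - mul y v) = rmul (- v) \+ lmul v.
  apply/funext => y; rewrite /= addrC; congr (_ + _).
  by rewrite -[mul y v]/(lmul y v) -linearN.
have comm y : rmul (- v) (lmul v y) = lmul v (rmul (- v) y).
  by rewrite /= (ba_mulA A_banach).
rewrite (exp_opD _ comm (op_bound_rmul _) (op_bound_lmul _)).
rewrite exp_op_rmul exp_op_lmul; split=> [e eP|_].
  rewrite !alg_exp_unital//.
  have -> : mul (e + alg_expm1 v) x = x + mul (alg_expm1 v) x.
    by rewrite -[LHS]/(rmul x _) linearD/= (eP x).1.
  by rewrite -[RHS]/(lmul _ _) linearD/= (eP _).2.
rewrite /= !alg_exp_unitization /unitization_mul/unitization_in/=.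
by rewrite mulr0 mul0r !scale0r !scale1r !addr0 !add0r.
Qed.

End Conjugation.

(** * Passage through sigma and construction of the group *)

(* Since [sigma \o D = D], iterating [D = ad \o sigma] yields [ad ^ n \o sigma]. *)
Lemma exp_op_sub_comp (R : realType) (k : scalar_kind)
    (V : completeNormedModType (scalar_field R k)) (D : {linear V -> V}) (m : R)
    (sigma ad : V -> V) :
  op_bound D m -> (forall a, D a = ad (sigma a)) ->
  (forall a, sigma (D a) = D a) ->
  forall a, exp_op D a + sigma a - a = exp_op ad (sigma a).
Proof.
move=> Dm Dad sigmaD a.
have iterE n : sigma (iter n D a) = iter n ad (sigma a).
  by elim: n => // n IH; rewrite !iterS sigmaD Dad IH.
apply/esym/cvg_lim => //; rewrite -cvg_shiftS /=.
(* The two sums differ only at n = 0, where they have [sigma a] and [a]; the index shift by one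
   exposes these terms. *)
have -> : (fun N => exp_sum ad N.+1 (sigma a)) =
    (fun N => exp_sum D N.+1 a + sigma a - a).
  apply/funext => N; rewrite /exp_sum !big_ord_recl/= invr1 !scale1r.
  rewrite -[_ + _ + sigma a]addrA [a + _]addrC addrK [RHS]addrC; congr (_ + _).
  by apply: eq_bigr => n _; rewrite /= -iterE Dad.
apply: cvgB; last exact: cvg_cst.
apply: cvgD; last exact: cvg_cst.
by have := @cvg_exp_op _ _ _ _ _ Dm a; rewrite -cvg_shiftS.
Qed.

Theorem theorem2p14 (R : realType) (k : scalar_kind)
    (A : completeNormedModType (scalar_field R k)) (mul : A -> A -> A)
    (A_banach : banach_algebra mul)
    (sigma : A -> A) (sigma_linear : linear sigma)
    (u : A) (d : A -> A)
    (d_inner : inner_sigma_derivation mul sigma u d)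
    (d_bounded : bounded_operator d)
    (sigma_idem : forall a, sigma (sigma a) = sigma a)
    (sigma_ur : forall a, sigma (mul a u) = mul (sigma a) u)
    (sigma_ul : forall a, sigma (mul u a) = mul u (sigma a)) :
  exists alpha : R -> A -> A,
    [/\ one_parameter_group alpha,
        is_generator alpha d &
        forall t, inner_sigma_endomorphism mul sigma (alpha t)].
Proof.
have [dE u_comm] := d_inner.
have [d_linear [m dm]] := (bounded_operator_op_bound d).1 d_bounded.
pose D : {linear A -> A} :=
  HB.pack d (GRing.isLinear.Build _ A A *:%R d d_linear).
pose S : {linear A -> A} :=
  HB.pack sigma (GRing.isLinear.Build _ A A *:%R sigma sigma_linear).
(* Applying [sigma] to u sigma(a) - sigma(a) u only replaces sigma(a) by sigma(sigma(a)), which is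
   sigma(a) again. *)
have sigma_d a : sigma (d a) = d a.
  rewrite dE -[LHS]/(S _) linearB/=.
  by rewrite sigma_ul sigma_ur sigma_idem.
have Dm : op_bound D m by [].
(* The group is e^(td); the bound on [d] makes its series converge. *)
exists (fun t => exp_op (real_scalar k t \*: D)); split.
- exact: exp_op_one_parameter_group Dm.
- exact: exp_op_generator Dm.
move=> t; set c := real_scalar k t.
split; first exact: exp_op_linear (op_boundZ c Dm).
have lmulZ x : mul (c *: u) x = c *: mul u x.
  by rewrite -[LHS]/(rmul A_banach x _) linearZ.
have rmulZ x : mul x (c *: u) = c *: mul x u.
  by rewrite -[LHS]/(lmul A_banach x _) linearZ.
(* td is the commutator with tu after [sigma], so v = tu; commutation with the defects of [sigma] is
   stable under scaling. *)
exists (c *: u); split=> [a|a b]; last by rewrite lmulZ rmulZ u_comm.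
rewrite (@exp_op_sub_comp _ _ _ _ _ _
  (fun y => mul (c *: u) y - mul y (c *: u)) (op_boundZ c Dm)).
- exact: exp_conjugate_exp_op.
- by move=> x; rewrite /= lmulZ rmulZ -scalerBr -dE.
- by move=> x; rewrite -[LHS]/(S _) linearZ /= sigma_d.
Qed.
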